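(* Let $\beta>1/2$ and let $X$ be a random variable with density $f_\beta(x)=C_\beta(1+x^2)^{-\beta}$, $x\in\mathbb R$. Then for every smooth $\phi:\mathbb R\to\mathbb R$ such that $\phi(X)$ has finite variance, $$\mathrm{Var}[\phi(X)]\le \frac{1}{\rho(\beta)}\,E\big\{(1+X^2)[\phi'(X)]^2\big\},\qquad \rho(\beta)=\begin{cases}(\beta-\tfrac12)^2, & \tfrac12<\beta\le\tfrac32,\\ 2(\beta-1), & \beta>\tfrac32.\end{cases}$$
   Context: $C_\beta>0$ is the normalizing constant making $f_\beta$ a probability density on $\mathbb R$. $\mathrm{Var}[\phi(X)]=E[\phi(X)^2]-(E[\phi(X)])^2$. *)

(* Defs.v *)
From HB Require Import structures.
From mathcomp Require Import all_boot all_order all_algebra.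
From mathcomp Require Import all_classical all_reals all_analysis.
Set Implicit Arguments. Unset Strict Implicit. Unset Printing Implicit Defensive.
Import Order.TTheory GRing.Theory Num.Theory.
Import numFieldNormedType.Exports.
Local Open Scope classical_set_scope.
Local Open Scope ring_scope.

Definition cauchy_kernel (R : realType) (beta : R) (x : R) : R :=
  (1 + x ^+ 2) `^ (- beta).

Definition C_beta (R : realType) (beta : R) : R :=
  (fine (\int[lebesgue_measure]_x (cauchy_kernel beta x)%:E)%E)^-1.

Definition f_beta (R : realType) (beta : R) (x : R) : R :=
  C_beta beta * cauchy_kernel beta x.

Definition rho (R : realType) (beta : R) : R :=
  if beta <= 3 / 2 then (beta - 1 / 2) ^+ 2 else 2 * (beta - 1).

Definition smooth (R : realType) (phi : R -> R) : Prop :=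
  forall (n : nat) (x : R), derivable (iter n (@derive1 R R) phi) x 1.

(* Main.v *)
Require Import Defs.
From HB Require Import structures.
From mathcomp Require Import all_boot all_order all_algebra.
From mathcomp Require Import all_classical all_reals all_analysis.
From mathcomp Require Import measurable_realfun ring lra.
Import Order.TTheory GRing.Theory Num.Theory.
Import numFieldNormedType.Exports.
Local Open Scope classical_set_scope.
Local Open Scope ring_scope.

(** Since [Var phi(X) <= E (phi(X) - phi 0)^2], it suffices to prove the Hardy
    inequality [rho int h^2 K <= int w h'^2 K] for functions with [h 0 = 0], where
    [w = 1 + x^2] and [K = w^(-beta)].  Put [g = x w^(gam/2)], with
    [gam = beta - 3/2] when [beta <= 3/2] and [gam = 0] otherwise.  This is a positive
    increasing supersolution, [(w K g')' <= - rho K g], on the half-line [x > 0], so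
    Picone's identity gives
      [(w K h^2 g'/g)' <= w K h'^2 - rho K h^2],
    and by oddness of [g] the same holds for [x < 0].  The function
    [F = w K h^2 g'/g = K (w + gam x^2) h^2 / x] is differentiable at [0] because
    [h 0 = 0], and it has the sign of [x]; integrating over [[-M, M]] and letting [M]
    tend to infinity proves the inequality. *)

(** * Calculus of the kernel, of [h^2 / x], and comparison of increments *)

Lemma continuous_derivable {R : realType} (f : R -> R) :
  (forall x : R, derivable f x 1) -> continuous f.
Proof.
by move=> df x; apply: differentiable_continuous; exact/derivable1_diffP.
Qed.

Lemma is_derive_cauchy_kernel {R : realType} (beta x : R) :
  is_derive x 1 (cauchy_kernel beta)
    (- (2 * beta * x / (1 + x ^+ 2)) * cauchy_kernel beta x).
Proof.
have w0 : 0 < 1 + x ^+ 2 by have := sqr_ge0 x; lra.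
have dw : is_derive x (1 : R) (fun y : R => 1 + y ^+ 2) (2 * x).
  by apply: is_derive_eq; rewrite /GRing.scale /= !mulr1; ring.
have dp := is_derive1_powR (- beta) w0.
have := @is_derive1_comp _ (fun y => y `^ (- beta)) (fun y => 1 + y ^+ 2) x _ _ dp dw.
rewrite -[_ \o _]/(cauchy_kernel beta) => dK.
apply: (is_derive_eq dK).
rewrite /GRing.scale /= /cauchy_kernel powRB ?(gt_eqF w0) ?implybT//.
rewrite powRr1 ?(ltW w0)//.
by field; rewrite gt_eqF.
Qed.

Lemma cauchy_kernel_gt0 {R : realType} (beta x : R) : 0 < cauchy_kernel beta x.
Proof. by apply: powR_gt0; have := sqr_ge0 x; lra. Qed.

Lemma continuous_cauchy_kernel {R : realType} (beta : R) :
  continuous (cauchy_kernel beta).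
Proof.
by apply: continuous_derivable => x; have [] := is_derive_cauchy_kernel beta x.
Qed.

(** As [h 0 = 0], and as division by zero gives [0], the difference quotient of [h^2 / x] at [0] is
    the square of that of [h]. This removes the singularity of [F]. *)
Lemma is_derive_sqr_divX0 {R : realType} (h : R -> R) (d : R) :
  h 0 = 0 -> is_derive (0 : R) (1 : R) h d ->
  is_derive (0 : R) (1 : R) (fun x => h x ^+ 2 / x) (d ^+ 2).
Proof.
move=> h0 hd.
have H : t^-1 *: (h (t *: 1 + 0) - h 0) @[t --> 0^'] --> d.
  have /cvg_ex[l Hl] : derivable h 0 1 by [].
  have <- : 'D_1 h 0 = d by exact: derive_val.
  by apply: (cvgP l).
have K : t^-1 *: (h (t *: 1 + 0) ^+ 2 / (t *: 1 + 0) - h 0 ^+ 2 / 0)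
    @[t --> 0^'] --> d ^+ 2.
  apply: cvg_trans (cvgM H H); apply: near_eq_cvg; apply: nearW => t.
  by rewrite /= h0 /GRing.scale /= !mulr1 !addr0 expr0n mul0r !subr0; ring.
apply: DeriveDef; first by apply: cvgP K.
by apply: (cvg_lim _ K).
Qed.

(** The primitive of [A] minus [F] has nonnegative derivative, hence is nondecreasing. Only [A] gets
    integrated, never [derive1 F]. *)
Lemma le_integral_of_derive1_le {R : realType} (F A : R -> R) (a b : R) : a < b ->
  continuous A -> (forall x : R, derivable F x 1) -> (forall x, derive1 F x <= A x) ->
  F b - F a <= \int[lebesgue_measure]_(x in `[a, b]) A x.
Proof.
move=> ab cA dF FA.
have iA u v : lebesgue_measure.-integrable `[u, v] (EFin \o A).
  apply: continuous_compact_integrable; first exact: segment_compact.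
  exact: continuous_subspaceT.
pose I x := (\int[lebesgue_measure]_(t in `[a, x]) A t).
have dI x : x \in `]a, b[ -> derivable I x 1 /\ derive1 I x = A x.
  rewrite in_itv /= => /andP[ax xb].
  exact: (continuous_FTC1_closed xb (iA a b) ax (cA x)).
have Iaa : I a = 0 by rewrite /I set_itv1 Rintegral_set1.
suff: I a - F a <= I b - F b by rewrite Iaa -[\int[_]_(_ in _) _]/(I b); lra.
pose G := I - F.
apply: (@ger0_derive1_ndecr _ G a b) => //.
- by move=> x /dI[dx _]; apply: derivableB.
- move=> x /[dup] xab /dI[dx dxE]; rewrite derive1E deriveB// -!derive1E dxE.
  by rewrite subr_ge0.
- have cI : {within `[a, b], continuous I}.
    by apply: parameterized_integral_continuous => //; exact: ltW.
  have cF : {within `[a, b], continuous F}.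
    by apply: continuous_subspaceT; exact: continuous_derivable.
  by move=> x; apply: cvgB; [exact: cI|exact: cF].
- exact: ltW.
Qed.

(** * Hardy inequality on symmetric intervals *)

(** Picone's inequality divided by [K], with [u = h / x] and [p = h']. The hypothesis on [lam] is
    the supersolution condition for [g], expressed in [s = x^2 / (1 + x^2)]. *)
Lemma hardy_pointwise {R : realType} (beta gam lam x u p : R) :
  (forall s : R, 0 <= s <= 1 ->
     lam <= (2 * beta - gam) * (1 + gam * s) - 2 - 2 * gam) ->
  2 * (1 + gam) * (x * u) ^+ 2
    - 2 * beta * (1 + x ^+ 2 + gam * x ^+ 2) / (1 + x ^+ 2) * (x * u) ^+ 2
    + (1 + x ^+ 2 + gam * x ^+ 2) * (2 * u * p - u ^+ 2)
  <= (1 + x ^+ 2) * p ^+ 2 - lam * (x * u) ^+ 2.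
Proof.
set w := 1 + x ^+ 2 => lamP.
have w0 : 0 < w by rewrite /w; have := sqr_ge0 x; lra.
pose s := x ^+ 2 / w.
have s01 : 0 <= s <= 1.
  by rewrite divr_ge0 ?sqr_ge0 ?(ltW w0)//= ler_pdivrMr// mul1r /w; lra.
have := lamP s s01; rewrite -subr_ge0 => l0.
rewrite -subr_ge0.
(* Since [x g' / g = 1 + gam * s], the first square is that of [h' - h g' / g]. *)
rewrite [leRHS](_ : _ = w * (p - (1 + gam * s) * u) ^+ 2 + (x * u) ^+ 2 *
   ((2 * beta - gam) * (1 + gam * s) - 2 - 2 * gam - lam)).
  by apply: addr_ge0; [rewrite mulr_ge0 ?sqr_ge0 ?ltW|rewrite mulr_ge0 ?sqr_ge0].
have xs : x ^+ 2 = s * w by rewrite /s divfK// gt_eqF.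
by rewrite !exprMn xs; field; rewrite gt_eqF.
Qed.

Lemma cauchy_hardy_itv {R : realType} (beta gam lam M : R) (h : R -> R) :
  -1 <= gam ->
  (forall s : R, 0 <= s <= 1 ->
     lam <= (2 * beta - gam) * (1 + gam * s) - 2 - 2 * gam) ->
  h 0 = 0 -> (forall x : R, derivable h x 1) -> continuous (derive1 h) -> 0 < M ->
  (\int[lebesgue_measure]_(x in `[(- M)%R, M])
     (lam * (h x ^+ 2 * cauchy_kernel beta x))%:E <=
   \int[lebesgue_measure]_(x in `[(- M)%R, M])
     ((1 + x ^+ 2) * derive1 h x ^+ 2 * cauchy_kernel beta x)%:E)%E.
Proof.
move=> gam1 lamP h0 dh cdh M0.
pose K := cauchy_kernel beta.
pose c x := K x * (1 + x ^+ 2 + gam * x ^+ 2).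
pose F x := c x * (h x ^+ 2 / x).
pose q x := lam * (h x ^+ 2 * K x).
pose p x := (1 + x ^+ 2) * derive1 h x ^+ 2 * K x.
have cK : continuous K by exact: continuous_cauchy_kernel.
have ch : continuous h by exact: continuous_derivable.
have cq : continuous q.
  move=> x; apply: cvgM; first exact: cvg_cst.
  by apply: cvgM; [apply: cvgM; exact: ch|exact: cK].
have cp : continuous p.
  move=> x; apply: cvgM; last exact: cK.
  apply: cvgM; last by apply: cvgM; exact: cdh.
  by apply: cvgD; [exact: cvg_cst|exact: exprn_continuous].
have dF (x : R) : is_derive x (1 : R) F
   (K x * (2 * (1 + gam) * x - 2 * beta * x * (1 + x ^+ 2 + gam * x ^+ 2) / (1 + x ^+ 2))
      * (h x ^+ 2 / x) +
    c x * (if x == 0 then derive1 h 0 ^+ 2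
           else 2 * (h x / x) * derive1 h x - (h x / x) ^+ 2)).
  have dK := is_derive_cauchy_kernel beta x.
  have dhx : is_derive x (1 : R) h (derive1 h x).
    by rewrite derive1E; exact: derivableP.
  have w0 : 1 + x ^+ 2 != 0 by rewrite gt_eqF//; have := sqr_ge0 x; lra.
  have dc : is_derive x (1 : R) c
      (K x * (2 * (1 + gam) * x - 2 * beta * x * (1 + x ^+ 2 + gam * x ^+ 2) / (1 + x ^+ 2))).
    by apply: is_derive_eq; rewrite /GRing.scale /= !mulr1 -/K; field.
  have dk : is_derive x (1 : R) (fun y => h y ^+ 2 / y) (if x == 0 then derive1 h 0 ^+ 2
           else 2 * (h x / x) * derive1 h x - (h x / x) ^+ 2).
    have [x0|x0] := eqVneq x 0.
      by rewrite x0; apply: is_derive_sqr_divX0 => //; rewrite -x0.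
    have dV : is_derive x (1 : R) (fun y : R => y^-1) (- x ^- 2).
      apply: DeriveDef; first exact: (@derivableV _ _ id).
      by rewrite (@deriveV _ _ id)// derive_id /GRing.scale /= mulr1.
    by apply: is_derive_eq; rewrite /GRing.scale /=; field.
  by apply: is_derive_eq; rewrite /GRing.scale /=; ring.
have FA x : derive1 F x <= p x - q x.
  rewrite derive1E (@derive_val _ _ _ _ _ _ _ (dF x)).
  (* At [0] both sides equal [K 0 * h'(0)^2]; elsewhere the pointwise bound is multiplied by
     [K x > 0]. *)
  have [->|x0] := eqVneq x 0.
    by rewrite /c /p /q h0 !expr0n /= !(mul0r,mulr0,addr0,add0r,subr0,mulr1,mul1r) mulrC.
  have := hardy_pointwise _ _ _ x (h x / x) (derive1 h x) lamP.
  rewrite -(ler_pM2r (cauchy_kernel_gt0 beta x)) -/(K x).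
  rewrite (_ : x * (h x / x) = h x); last by rewrite mulrCA divff// mulr1.
  rewrite /c /p /q => H; apply: le_trans (le_trans H _).
    rewrite le_eqVlt; apply/orP; left; apply/eqP.
    by field; rewrite x0 /= gt_eqF//; have := sqr_ge0 x; lra.
  by rewrite le_eqVlt; apply/orP; left; apply/eqP; ring.
have ip : lebesgue_measure.-integrable `[- M, M] (EFin \o p).
  apply: continuous_compact_integrable; first exact: segment_compact.
  exact: continuous_subspaceT.
have iq : lebesgue_measure.-integrable `[- M, M] (EFin \o q).
  apply: continuous_compact_integrable; first exact: segment_compact.
  exact: continuous_subspaceT.
have := @le_integral_of_derive1_le _ F (fun x => p x - q x) (- M) M.
rewrite RintegralB// => /(_ _ _ _ FA) H.
have {}H : F M - F (- M) <= \int[lebesgue_measure]_(x in `[- M, M]) p x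
  - \int[lebesgue_measure]_(x in `[- M, M]) q x.
  apply: H; first by lra.
    by move=> x; apply: cvgB; [exact: cp|exact: cq].
  by move=> x; have [] := dF x.
have cM x : 0 <= c x.
  rewrite /c mulr_ge0 ?(ltW (cauchy_kernel_gt0 _ _))//.
  have := sqr_ge0 x; nra.
have FM : 0 <= F M by rewrite mulr_ge0 ?cM ?divr_ge0 ?sqr_ge0 ?(ltW M0).
have FNM : F (- M) <= 0.
  by rewrite /F invrN mulrN mulrN oppr_le0 mulr_ge0 ?cM ?divr_ge0 ?sqr_ge0 ?(ltW M0).
have : \int[lebesgue_measure]_(x in `[- M, M]) q x <=
  \int[lebesgue_measure]_(x in `[- M, M]) p x by lra.
by rewrite -lee_fin /Rintegral !fineK//; exact: integrable_fin_num.
Qed.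

(** * Expectations under a density, and the variance *)

(** Here [nu] is absolutely continuous with respect to [mu], and [f] has the same integrals over
    measurable sets as the Radon-Nikodym derivative. The two thus agree almost everywhere, and the
    change of variables passes to [f]. *)
Lemma ge0_integral_density {R : realType} {d : measure_display}
    {T : measurableType d} (nu : {finite_measure set T -> \bar R})
    (mu : {sigma_finite_measure set T -> \bar R}) (f g : T -> R) :
  measurable_fun [set: T] f ->
  (forall A : set T, measurable A -> nu A = (\int[mu]_(x in A) (f x)%:E)%E) ->
  measurable_fun [set: T] g -> (forall x, 0 <= g x) ->
  (\int[nu]_x (g x)%:E = \int[mu]_x (g x * f x)%:E)%E.
Proof.
move=> mf nuf /measurable_EFinP mg g0.
have numu : nu `<< mu.
  apply/null_content_dominatesP => A mA A0; rewrite /= nuf//.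
  by apply: null_set_integral => //; apply/measurable_funTS/measurable_EFinP.
rewrite -(Radon_Nikodym_SigmaFinite.change_of_variables numu)//.
under [RHS]eq_integral do rewrite EFinM.
have mh := measurable_int _ (Radon_Nikodym_SigmaFinite.f_integrable numu).
apply: ae_eq_integral => //.
- exact: emeasurable_funM.
- by apply: emeasurable_funM => //; exact/measurable_EFinP.
- apply: ae_eqe_mul2l; apply: integral_ae_eq => //=.
  + exact: Radon_Nikodym_SigmaFinite.f_integrable.
  + exact/measurable_EFinP.
  + by move=> E _ mE; rewrite -Radon_Nikodym_SigmaFinite.f_integral// nuf.
Qed.

Lemma ge0_expectation_density {R : realType} {d : measure_display}
    {T : measurableType d} {P : probability T R} (X : {RV P >-> R}) (f g : R -> R) :
  measurable_fun [set: R] f ->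
  (forall A : set R, measurable A ->
     distribution P X A = (\int[lebesgue_measure]_(x in A) (f x)%:E)%E) ->
  measurable_fun [set: R] g -> (forall x, 0 <= g x) ->
  ('E_P[fun w => g (X w)] = \int[lebesgue_measure]_x (g x * f x)%:E)%E.
Proof.
move=> mf hX mg g0.
have mX : @measurable_fun _ _ T (measurableTypeR R) [set: T] X.
  exact: (@measurable_funPT _ _ _ _ X).
(* The canonical measurable structure on [R] carries a different display from the
   one of [lebesgue_measure], hence the repackaging of [X]. *)
pose X' : {RV P >-> measurableTypeR R} :=
  @mfun_Sub _ _ T (measurableTypeR R) X (mem_set mX).
rewrite -(@ge0_integral_density R _ (measurableTypeR R) (distribution P X')
    (@lebesgue_measure R) f g mf hX mg g0).
rewrite unlock (@ge0_integral_distribution _ _ _ _ _ P X' (EFin \o g))//.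
exact/measurable_EFinP.
Qed.

(** Variance is invariant under the shift by [- c], and that of the shifted variable is its second
    moment minus the square of a finite mean. *)
Lemma variance_le_expectation_sqrB {R : realType} {d : measure_display}
    {T : measurableType d} (P : probability T R) (Y : T -> R) (c : R) :
  Y \in Lfun P 2%:E -> ('V_P[Y] <= 'E_P[fun w => ((Y w - c) ^+ 2)%R])%E.
Proof.
move=> Y2.
have Yc2 : (Y + cst (- c))%R \in Lfun P 2%:E.
  by apply: rpredD => //=; rewrite ?lee1n ?Lfun_cst//.
rewrite -(varianceD_cst_r (- c) Y2) varianceE//.
rewrite leeBlDr ?fin_numX ?expectation_fin_num//; last first.
  by rewrite Lfun_subset12 ?fin_num_measure.
by apply: leeDl; exact: sqre_ge0.
Qed.

(** * Passage to the whole line *)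

(** Monotone convergence. The radius [n + 1] is positive from [n = 0] on, as the interval inequality
    requires, and exceeds [|x|] at [n = truncn |x|]. *)
Lemma cvg_ge0_integral_itvNn {R : realType} (f : R -> R) :
  continuous f -> (forall x, 0 <= f x) ->
  (\int[lebesgue_measure]_(x in `[(- n.+1%:R)%R, n.+1%:R]) (f x)%:E @[n --> \oo] -->
   \int[lebesgue_measure]_x (f x)%:E)%E.
Proof.
move=> cf f0; pose S n : set R := `[- n.+1%:R, n.+1%:R]%classic.
have ST : \bigcup_n S n = setT.
  apply/seteqP; split=> // x _; exists (Num.truncn `|x|) => //.
  by rewrite /S /= in_itv /= -ler_norml ltW// truncnS_gt.
have := @ge0_nondecreasing_set_cvg_integral _ (measurableTypeR R) _ S (EFin \o f)
  (@lebesgue_measure R).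
rewrite ST; apply.
- apply/nondecreasing_seqP => n; rewrite subsetEset.
  by apply: subset_itv; rewrite bnd_simp ?lerN2 ler_nat.
- by move=> n; exact: measurable_itv.
- move=> n; apply: measurable_funTS; apply/measurable_EFinP.
  exact: continuous_measurable_fun.
- by move=> n x _; rewrite lee_fin.
Qed.

(** With [0 <= lam] both integrands are nonnegative, so the interval inequalities pass to the limit
    in the extended reals, where either side may be infinite. *)
Lemma cauchy_hardy {R : realType} (beta gam lam : R) (h : R -> R) :
  -1 <= gam -> 0 <= lam ->
  (forall s : R, 0 <= s <= 1 ->
     lam <= (2 * beta - gam) * (1 + gam * s) - 2 - 2 * gam) ->
  h 0 = 0 -> (forall x : R, derivable h x 1) -> continuous (derive1 h) ->
  (\int[lebesgue_measure]_x (lam * (h x ^+ 2 * cauchy_kernel beta x))%:E <=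
   \int[lebesgue_measure]_x
     ((1 + x ^+ 2) * derive1 h x ^+ 2 * cauchy_kernel beta x)%:E)%E.
Proof.
move=> gam1 lam0 lamP h0 dh cdh.
have cK : continuous (cauchy_kernel beta) := continuous_cauchy_kernel beta.
have K0 x : 0 <= cauchy_kernel beta x := ltW (cauchy_kernel_gt0 beta x).
have ch : continuous h := continuous_derivable _ dh.
have /cvg_ge0_integral_itvNn q_cvg :
    continuous (fun x : R => lam * (h x ^+ 2 * cauchy_kernel beta x)).
  move=> x; apply: cvgM; first exact: cvg_cst.
  by apply: cvgM; [apply: cvgM; exact: ch|exact: cK].
have /cvg_ge0_integral_itvNn p_cvg :
    continuous (fun x : R => (1 + x ^+ 2) * derive1 h x ^+ 2 * cauchy_kernel beta x).
  move=> x; apply: cvgM; last exact: cK.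
  apply: cvgM; last by apply: cvgM; exact: cdh.
  by apply: cvgD; [exact: cvg_cst|exact: exprn_continuous].
have {}q_cvg := q_cvg (fun x => mulr_ge0 lam0 (mulr_ge0 (sqr_ge0 (h x)) (K0 x))).
have {}p_cvg := p_cvg (fun x => mulr_ge0 (mulr_ge0
  (addr_ge0 ler01 (sqr_ge0 x)) (sqr_ge0 (derive1 h x))) (K0 x)).
rewrite -(cvg_lim _ q_cvg)// -(cvg_lim _ p_cvg)//.
apply: lee_lim; [exact: cvgP q_cvg|exact: cvgP p_cvg|].
by apply: nearW => n; apply: (cauchy_hardy_itv _ _ _ _ _ gam1 lamP).
Qed.

(** * The constant [rho] and the variance bound *)

Lemma rho_gt0 {R : realType} (beta : R) : 1 / 2 < beta -> 0 < rho beta.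
Proof. by rewrite /rho => b; case: ifPn => b2; [rewrite exprn_gt0; lra|lra]. Qed.

Lemma cauchy_hardy_rho {R : realType} (beta : R) (h : R -> R) :
  1 / 2 < beta ->
  h 0 = 0 -> (forall x : R, derivable h x 1) -> continuous (derive1 h) ->
  (\int[lebesgue_measure]_x (rho beta * (h x ^+ 2 * cauchy_kernel beta x))%:E <=
   \int[lebesgue_measure]_x
     ((1 + x ^+ 2) * derive1 h x ^+ 2 * cauchy_kernel beta x)%:E)%E.
Proof.
move=> b12; have := ltW (rho_gt0 _ b12); rewrite /rho.
case: ifPn => [b32|b32] lam0.
  (* At [s = 1] the bound on [lam] reads [(1 + gam) (2 beta - 2 - gam)]; its maximum over [gam] is
     [(beta - 1/2)^2], attained at [beta - 3/2]. *)
  apply: (@cauchy_hardy _ _ (beta - 3 / 2)) => //; first by lra.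
  move=> s /andP[s0 s1]; rewrite -subr_ge0.
  rewrite [leRHS](_ : _ = (3 / 2 - beta) * (3 / 2 + beta) * (1 - s)); last by field.
  by rewrite !mulr_ge0//; lra.
(* For [gam = 0] the bound on [lam] is [2 beta - 2] for every [s]. *)
by apply: (@cauchy_hardy _ _ 0) => // *; lra.
Qed.

Theorem theorem2p2 (R : realType) (beta : R) (hbeta : 1 / 2 < beta)
  (d : measure_display) (T : measurableType d) (P : probability T R)
  (X : {RV P >-> R})
  (hX : forall A : set R, measurable A ->
     distribution P X A = (\int[lebesgue_measure]_(x in A) (f_beta beta x)%:E)%E)
  (phi : R -> R) (hphi : smooth phi)
  (hvar : (phi \o X) \in Lfun P 2%:E) :
  ('V_P[phi \o X] <=
   (rho beta)^-1%:E * 'E_P[fun w => ((1 + X w ^+ 2) * (derive1 phi (X w)) ^+ 2)%R])%E.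
Proof.
have dphi (x : R) : derivable phi x 1 := hphi 0%N x.
have cdphi : continuous (derive1 phi).
  by apply: continuous_derivable => x; exact: (hphi 1%N x).
(* Centring at [phi 0] instead of the mean makes [h] vanish at [0]. *)
pose h x := phi x - phi 0.
have dh (x : R) : derivable h x 1 by apply: derivableB.
have dhE : derive1 h = derive1 phi.
  by apply/funext => x; rewrite !derive1E deriveB// derive_cst subr0.
have ch : continuous h := continuous_derivable _ dh.
have cK : continuous (cauchy_kernel beta) := continuous_cauchy_kernel beta.
have K0 x : 0 <= cauchy_kernel beta x := ltW (cauchy_kernel_gt0 beta x).
pose C := C_beta beta.
have C0 : 0 <= C.
  by rewrite invr_ge0 fine_ge0// integral_ge0// => x _; rewrite lee_fin.
have mf : measurable_fun [set: R] (f_beta beta).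
  by apply: continuous_measurable_fun => x; apply: cvgM; [exact: cvg_cst|exact: cK].
have EE (g : R -> R) : continuous g -> (forall x, 0 <= g x) ->
    ('E_P[fun w => g (X w)] =
     C%:E * \int[lebesgue_measure]_x (g x * cauchy_kernel beta x)%:E)%E.
  move=> cg g0; have mg : measurable_fun [set: R] g by exact: continuous_measurable_fun.
  rewrite (ge0_expectation_density _ _ _ mf hX mg g0).
  rewrite -ge0_integralZl_EFin//.
  - by apply: eq_integral => x _; rewrite -EFinM /f_beta mulrCA.
  - by move=> x _; rewrite lee_fin mulr_ge0.
  - apply/measurable_EFinP; apply: measurable_funM => //.
    exact: continuous_measurable_fun.
rewrite lee_pdivlMl ?rho_gt0//.
apply: (@le_trans _ _ ((rho beta)%:E * 'E_P[fun w => (h (X w) ^+ 2)%R])%E).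
  rewrite lee_pmul2l ?lte_fin ?rho_gt0//; exact: variance_le_expectation_sqrB.
have ch2 : continuous (fun x : R => h x ^+ 2) by move=> x; apply: cvgM; exact: ch.
rewrite (EE (fun x => h x ^+ 2))//; last by move=> x; exact: sqr_ge0.
rewrite (EE (fun x => (1 + x ^+ 2) * derive1 phi x ^+ 2)); first last.
- by move=> x; rewrite mulr_ge0 ?sqr_ge0// addr_ge0 ?sqr_ge0.
- move=> x; apply: cvgM; last by apply: cvgM; exact: cdphi.
  by apply: cvgD; [exact: cvg_cst|exact: exprn_continuous].
(* Both sides carry the factor [C >= 0]; removing it leaves the Hardy inequality for [h]. *)
rewrite muleCA lee_wpmul2l ?lee_fin// -dhE -ge0_integralZl_EFin//.
- by apply: cauchy_hardy_rho => //; rewrite ?dhE// /h subrr.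
- by move=> x _; rewrite lee_fin mulr_ge0 ?sqr_ge0.
- apply/measurable_EFinP; apply: measurable_funM.
    exact: continuous_measurable_fun.
  exact: continuous_measurable_fun.
- exact/ltW/rho_gt0.
Qed.
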